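(* Let $n\geq 2$ be an integer and let $\{f_k\}_{k=0}^{n}$ be a sequence of non-negative real numbers such that $f_k^2>f_{k-1}f_{k+1}$ for all $k=1,2,\ldots,n-1$. Then the polynomial $$ P_{n}(x)=\sum_{k=0}^{n}f_{k}f_{n-k}\binom{n}{k}\left[(x)_k(x)_{n-k}-(x+1)_k(x-1)_{n-k}\right] $$ has degree $n-2$ and positive coefficients, i.e. the coefficient of $x^j$ in $P_n(x)$ is strictly positive for each $j=0,1,\ldots,n-2$, and the coefficient of $x^j$ is zero for all $j>n-2$.
   Context: For a (real or formal) variable $a$ and integer $m\geq 0$, $(a)_m$ denotes the rising factorial (Pochhammer symbol): $(a)_0=1$ and $(a)_m=a(a+1)\cdots(a+m-1)$ for $m\geq 1$. In particular $(x-1)_m=(x-1)x(x+1)\cdots(x+m-2)$ and $(x+1)_m=(x+1)(x+2)\cdots(x+m)$ for $m\ge 1$, so $P_n$ is a polynomial in $x$ with real coefficients. *)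

(* Defs.v *)
From mathcomp Require Import all_boot all_order all_algebra.
From mathcomp Require Import reals.
Set Implicit Arguments.
Unset Strict Implicit.
Unset Printing Implicit Defensive.
Import Order.TTheory GRing.Theory Num.Theory.
Local Open Scope ring_scope.

(* The rising convention: (a)_m = a (a + 1) ... (a + m - 1), with (a)_0 = 1. *)
Definition pochhammer (A : comNzRingType) (a : A) (m : nat) : A :=
  \prod_(i < m) (a + i%:R).

Definition Pn (R : realType) (n : nat) (f : nat -> R) : {poly R} :=
  \sum_(k < n.+1) (f k * f (n - k)%N * ('C(n, k))%:R) *:
    (pochhammer 'X k * pochhammer 'X (n - k)
     - pochhammer ('X + 1) k * pochhammer ('X - 1) (n - k)).

(* Main.v *)
Require Import Defs.
From mathcomp Require Import all_boot all_order all_algebra.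
From mathcomp Require Import reals.
From mathcomp Require Import ring.
Set Implicit Arguments.
Unset Strict Implicit.
Unset Printing Implicit Defensive.
Import Order.TTheory GRing.Theory Num.Theory.
Local Open Scope ring_scope.

(** Write [n = N + 1], [(a)_m] for the rising factorial and
    [w_k = f_k f_(n-k)].
    The Chu-Vandermonde identity gives the sums over [k] of both
    [C(n,k) (x)_k (x)_(n-k)] and [C(n,k) (x+1)_k (x-1)_(n-k)] the same value
    [(2x)_n]. So the brackets of [P_n], weighted by binomials, sum to zero,
    and in fact they telescope:
      [C(n,k) ((x)_k (x)_(n-k) - (x+1)_k (x-1)_(n-k)) = H_(k+1) - H_k]
    with [H_(i+1) = n C(N,i) (x+1)_i (x)_(N-i)] and [H_0 = H_(n+1) = 0]
    (lemma [pochhammer_shift_diff]). Summation by parts turns [P_n] into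
      [sum_(i <= N) n C(N,i) (w_i - w_(i+1)) (x+1)_i (x)_(N-i)]
    (lemma [Pn_by_parts]).

    Since [w] is symmetric, [w_i - w_(i+1)] changes sign under [i -> N - i].
    Averaging the sum with its reflection pairs each factor [w_(i+1) - w_i]
    with the polynomial [(x)_i (x+1)_(N-i) - (x+1)_i (x)_(N-i)]
    (lemma [Pn_symmetrized]). Both factors are odd under the reflection, so
    that it is enough to look at [i < N - i]. There the number is positive by
    log-concavity ([logconcave_spread]), and the polynomial equals
    [(N - 2i) (x)_i (x+1)_(N-i-1)] ([pochhammer_cross_diff]), which has degree
    [n - 2] and non-negative coefficients. The term [i = 0] carries
    [(x+1)_(n-2)], whose coefficients up to degree [n - 2] are all positive. *)

(** * Rising factorials *)

Section Pochhammer.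
Variable A : comNzRingType.
Implicit Types (a : A) (k l m p : nat).

Lemma pochhammer0 a : pochhammer a 0 = 1.
Proof. by rewrite /pochhammer big_ord0. Qed.

Lemma pochhammerSr a m : pochhammer a m.+1 = pochhammer a m * (a + m%:R).
Proof. by rewrite /pochhammer big_ord_recr. Qed.

Lemma pochhammerSl a m : pochhammer a m.+1 = a * pochhammer (a + 1) m.
Proof.
rewrite /pochhammer big_ord_recl /= addr0; congr (_ * _).
by apply: eq_bigr => i _; rewrite /bump /= natrD; ring.
Qed.

(** The telescoping certificate (a Wilf-Zeilberger pair) for the
    Chu-Vandermonde sum: after multiplication by [C(k + l, k)] the right-hand
    side becomes a difference of consecutive values in [k]. The truncated
    predecessors are harmless, being multiplied by [0] when they truncate. *)
Lemma pochhammer_shift_diff a k l :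
  pochhammer a k * pochhammer a l - pochhammer (a + 1) k * pochhammer (a - 1) l
  = l%:R * (pochhammer (a + 1) k * pochhammer a l.-1)
    - k%:R * (pochhammer (a + 1) k.-1 * pochhammer a l).
Proof.
have shift m : pochhammer (a - 1) m.+1 = (a - 1) * pochhammer a m.
  by rewrite pochhammerSl subrK.
case: k l => [|k] [|l]; rewrite ?pochhammer0 /= ?shift.
- by ring.
- by rewrite pochhammerSr -[l.+1]addn1 natrD; ring.
- by rewrite (pochhammerSl a) pochhammerSr -[k.+1]addn1 natrD; ring.
rewrite (pochhammerSl a k) (pochhammerSr (a + 1)) (pochhammerSr a l).
by rewrite -[l.+1]addn1 -[k.+1]addn1 !natrD; ring.
Qed.

(** Up to the shift of one argument both products have the same factors: the
    identity [a (a+1)_p = (a)_p (a+p)] exchanges the shift for a linear factor,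
    and the two linear factors that remain differ by a constant. *)
Lemma pochhammer_cross_diff a p m :
  pochhammer a p * pochhammer (a + 1) m.+1
  - pochhammer (a + 1) p * pochhammer a m.+1
  = (m.+1%:R - p%:R) * (pochhammer a p * pochhammer (a + 1) m).
Proof.
have swap : a * pochhammer (a + 1) p = pochhammer a p * (a + p%:R).
  by rewrite -pochhammerSl pochhammerSr.
rewrite (pochhammerSl a m) (pochhammerSr (a + 1)) -[m.+1]addn1 natrD.
rewrite [X in _ - X](_ : _ = a * pochhammer (a + 1) p * pochhammer (a + 1) m);
  last by ring.
by rewrite swap; ring.
Qed.

End Pochhammer.

(** * Coefficients of rising factorials *)

Section PochhammerCoef.
Variable R : realType.
Implicit Types (c : R) (m j : nat).

Lemma XaddC_natr c m : ('X + c%:P + m%:R : {poly R}) = 'X + (c + m%:R)%:P.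
Proof. by rewrite polyCD polyC_natr addrA. Qed.

Lemma coef_mul_ge0 (p q : {poly R}) :
  (forall j, 0 <= p`_j) -> (forall j, 0 <= q`_j) -> forall j, 0 <= (p * q)`_j.
Proof.
by move=> p_ge0 q_ge0 j; rewrite coefM sumr_ge0 // => i _; rewrite mulr_ge0.
Qed.

Lemma pochhammerX_ge0 c m j : 0 <= c -> 0 <= (pochhammer ('X + c%:P) m)`_j.
Proof.
move=> c_ge0; elim: m j => [|m IHm] j.
  by rewrite pochhammer0 coef1 ler0n.
rewrite pochhammerSr XaddC_natr coef_mul_ge0 // => {}j.
rewrite coefD coefX coefC addr_ge0 ?ler0n //.
by case: ifP => // _; rewrite addr_ge0.
Qed.

Lemma size_pochhammerX c m : size (pochhammer ('X + c%:P) m) = m.+1.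
Proof.
elim: m => [|m IHm]; first by rewrite pochhammer0 size_poly1.
have nz : pochhammer ('X + c%:P) m != 0 by rewrite -size_poly_eq0 IHm.
rewrite pochhammerSr XaddC_natr size_mul //; last first.
  by rewrite -size_poly_eq0 size_XaddC.
by rewrite IHm size_XaddC addn2.
Qed.

Lemma pochhammerX_gt0 c m j : 0 < c -> (j <= m)%N ->
  0 < (pochhammer ('X + c%:P) m)`_j.
Proof.
move=> c_gt0; elim: m j => [|m IHm] j le_jm.
  by move: le_jm; rewrite leqn0 => /eqP->; rewrite pochhammer0 coefC /= ltr01.
have cm_gt0 : 0 < c + m%:R by rewrite ltr_wpDr.
rewrite pochhammerSr XaddC_natr mulrDr coefD coefMX coefMC.
case: j le_jm => [|j] le_jm /=; first by rewrite add0r mulr_gt0 ?IHm.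
by rewrite ltr_wpDr ?IHm // mulr_ge0 ?pochhammerX_ge0 // ltW.
Qed.

Definition cross_diff p q : {poly R} :=
  pochhammer 'X p * pochhammer ('X + 1) q
  - pochhammer ('X + 1) p * pochhammer 'X q.

Lemma cross_diffC p q : cross_diff q p = - cross_diff p q.
Proof.
by rewrite /cross_diff opprB mulrC [pochhammer _ q * pochhammer 'X p]mulrC.
Qed.

Lemma cross_diffS p m : (p <= m.+1)%N ->
  cross_diff p m.+1
  = (m.+1 - p)%:R *: (pochhammer 'X p * pochhammer ('X + 1) m).
Proof.
move=> le_pm; rewrite /cross_diff pochhammer_cross_diff -natrB //.
by rewrite mulr_natl scaler_nat.
Qed.

Lemma cross_diff_ge0 p q j : (p <= q)%N -> 0 <= (cross_diff p q)`_j.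
Proof.
case: q => [|m] le_pq.
  move: le_pq; rewrite leqn0 => /eqP->.
  by rewrite /cross_diff mulrC subrr coef0.
rewrite cross_diffS // coefZ mulr_ge0 // coef_mul_ge0 // => i.
  by have := pochhammerX_ge0 p i (lexx 0); rewrite addr0.
by have := pochhammerX_ge0 m i ler01; rewrite polyC1.
Qed.

(** Both products are monic of degree [p + q], so that the difference loses one
    degree; with [p + q = n - 1] this gives the degree [n - 2] of [P_n]. *)
Lemma size_cross_diff p q : (size (cross_diff p q) <= p + q)%N.
Proof.
wlog le_pq : p q / (p <= q)%N => [IH|].
  case/orP: (leq_total p q) => [/IH //|/IH].
  by rewrite cross_diffC size_polyN addnC.
case: q le_pq => [|m] le_pq.
  move: le_pq; rewrite leqn0 => /eqP->.
  by rewrite /cross_diff mulrC subrr size_poly0.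
rewrite cross_diffS // (leq_trans (size_scale_leq _ _)) //.
rewrite (leq_trans (size_polyMleq _ _)) //.
have := size_pochhammerX 0 p; rewrite addr0 => ->.
by have := size_pochhammerX 1 m; rewrite polyC1 => ->; rewrite addSn addnS.
Qed.

End PochhammerCoef.

(** * Log-concave sequences *)

Section LogConcave.
Variables (R : realType) (n : nat) (f : nat -> R).
Hypothesis f_ge0 : forall k : nat, (k <= n)%N -> 0 <= f k.
Hypothesis f_logconcave : forall k : nat, (1 <= k <= n - 1)%N ->
  f (k - 1)%N * f (k + 1)%N < f k ^+ 2.

Lemma logconcaveS k : (k.+1 < n)%N -> f k * f k.+2 < f k.+1 * f k.+1.
Proof.
move=> lt_kn; have := @f_logconcave k.+1.
rewrite [(k.+1 - 1)%N]subn1 addn1 expr2; apply.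
by rewrite leq_subRL ?add1n // (leq_trans _ lt_kn).
Qed.

Lemma logconcave_gt0 k : (0 < k < n)%N -> 0 < f k.
Proof.
case: k => // k /andP[_ lt_kn]; have fk_ge0 := f_ge0 (ltnW lt_kn).
rewrite lt_def fk_ge0 andbT; apply: contraTneq (logconcaveS lt_kn) => ->.
by rewrite mulr0 -leNgt mulr_ge0 // f_ge0 // ltnW // ltnW.
Qed.

(** Log-concavity says that [f (k+1) / f k] decreases, and this compares the
    ratios at [p] and at [q]. In terms of [w], the products [f p * f q] with
    [p + q] fixed increase as the indices approach each other. The outermost
    values of [f] may vanish, so that only interior values are divided by. *)
Lemma logconcave_spread p q : (p < q < n)%N -> f p * f q.+1 < f p.+1 * f q.
Proof.
case/andP; elim: q => // q IHq.
rewrite ltnS leq_eqVlt => /predU1P[->|lt_pq] lt_qn.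
  exact: logconcaveS.
have fq_gt0 : 0 < f q.
  by apply: logconcave_gt0; rewrite (leq_ltn_trans _ lt_pq) //= ltnW.
have fq1_gt0 : 0 < f q.+1 by apply: logconcave_gt0.
have fp_ge0 : 0 <= f p by rewrite f_ge0 // ltnW // (ltn_trans lt_pq) // ltnW.
(* Chain the two ratio comparisons, having cleared the denominator [f q]. *)
rewrite -(ltr_pM2r fq_gt0) -mulrA [f q.+2 * _]mulrC.
apply: (@le_lt_trans _ _ (f p * (f q.+1 * f q.+1))).
  by rewrite ler_wpM2l // ltW // logconcaveS.
rewrite mulrA -[ltRHS]mulrA [f q.+1 * f q]mulrC mulrA ltr_pM2r //.
by rewrite IHq // ltnW.
Qed.

End LogConcave.

(** * Summation by parts and symmetrization *)

Section Pn.
Variables (R : realType) (N : nat) (f : nat -> R).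

Let x : {poly R} := 'X.

(** Abel summation of the telescoping form: since the [k]-th weighted bracket is
    [w_k (H_(k+1) - H_k)], collecting the factor of each [H_(i+1)] leaves the
    difference [w_i - w_(i+1)]; both boundary values [H_0] and [H_(n+1)] are
    zero. *)
Lemma Pn_by_parts :
  Pn N.+1 f = \sum_(i < N.+1)
    (N.+1%:R * 'C(N, i)%:R * (f i * f (N - i).+1 - f i.+1 * f (N - i)%N))
      *: (pochhammer (x + 1) i * pochhammer x (N - i)).
Proof.
pose u k l := f k * f l * 'C(N.+1, k)%:R.
transitivity (\sum_(k < N.+2) (
     (u k (N.+1 - k)%N * (N.+1 - k)%:R)
       *: (pochhammer (x + 1) k * pochhammer x (N.+1 - k).-1)
   - (u k (N.+1 - k)%N * k%:R)
       *: (pochhammer (x + 1) k.-1 * pochhammer x (N.+1 - k)))).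
  have natZ (m : nat) (p : {poly R}) : m%:R * p = m%:R *: p.
    by rewrite mulr_natl scaler_nat.
  apply: eq_bigr => k _; rewrite pochhammer_shift_diff natZ [X in _ - X]natZ.
  by rewrite scalerBr !scalerA.
rewrite sumrB big_ord_recr [X in _ - X]big_ord_recl /=.
rewrite subnn !mulr0 !scale0r addr0 add0r -sumrB.
apply: eq_bigr => i _; have le_iN : (i <= N)%N by rewrite -ltnS.
rewrite /bump /= add1n subSS subSn //= -scalerBl; congr (_ *: _).
have binl : 'C(N.+1, i)%:R * (N - i).+1%:R = N.+1%:R * 'C(N, i)%:R :> R.
  by rewrite -!natrM mulnC -subSn // -mul_bin_down.
have binr : 'C(N.+1, i.+1)%:R * i.+1%:R = N.+1%:R * 'C(N, i)%:R :> R.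
  by rewrite -!natrM mulnC mul_bin_diag.
by rewrite /u -!mulrA binl binr; ring.
Qed.

(** The sum of the two copies of [P_n] in which [i] runs forwards and backwards.
    Doubling, rather than folding the sum onto [i < N - i], avoids a separate
    treatment of the middle index. *)
Lemma Pn_symmetrized :
  Pn N.+1 f *+ 2 = \sum_(i < N.+1)
    (N.+1%:R * 'C(N, i)%:R)
      *: ((f i.+1 * f (N - i)%N - f i * f (N - i).+1)
          *: cross_diff R i (N - i)).
Proof.
rewrite mulr2n {1}Pn_by_parts (reindex_inj rev_ord_inj) Pn_by_parts -big_split.
apply: eq_bigr => i _; have le_iN : (i <= N)%N by rewrite -ltnS.
rewrite /= subSS subKn // bin_sub // -!scalerA -!scalerDr.
congr (_ *: (_ *: _)); set e := (X in _ = X *: _).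
rewrite [X in X *: _](_ : _ = e); last by rewrite /e; ring.
rewrite [X in _ + X *: _](_ : _ = - e); last by rewrite /e; ring.
by rewrite scaleNr -scalerBr [pochhammer (x + 1) _ * _]mulrC.
Qed.

End Pn.

(** * Positivity *)

Theorem theorem1 (R : realType) (n : nat) (f : nat -> R)
  (hn : (2 <= n)%N)
  (f_ge0 : forall k : nat, (k <= n)%N -> 0 <= f k)
  (f_logconcave : forall k : nat, (1 <= k <= n - 1)%N ->
     f (k - 1)%N * f (k + 1)%N < f k ^+ 2) :
  [/\ size (Pn n f) = (n - 2).+1,
      forall j : nat, (j <= n - 2)%N -> 0 < (Pn n f)`_j
    & forall j : nat, (n - 2 < j)%N -> (Pn n f)`_j = 0].
Proof.
have spread p q : (p < q < n)%N -> 0 < f p.+1 * f q - f p * f q.+1.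
  by move=> lt_pqn; rewrite subr_gt0 (logconcave_spread f_ge0 f_logconcave).
case: n hn {f_ge0 f_logconcave} spread => [|[|M]] // _ spread.
rewrite subn2 /=; set P := Pn M.+2 f.
pose t i := (f i.+1 * f (M.+1 - i)%N - f i * f (M.+1 - i).+1)
              *: cross_diff R i (M.+1 - i).
have symP j :
    P`_j *+ 2 = \sum_(i < M.+2) M.+2%:R * 'C(M.+1, i)%:R * (t i)`_j.
  by rewrite -coefMn Pn_symmetrized coef_sum; apply: eq_bigr => i _;
     rewrite coefZ.
have t_ge0 i j : (i <= M.+1)%N -> 0 <= (t i)`_j.
  move=> le_iM; rewrite coefZ.
  have := subKn le_iM; have := leq_subr i M.+1.
  move: (M.+1 - i)%N => q le_qM def_i.
  case: (ltngtP i q) => [lt_iq|lt_qi|->].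
  - by rewrite mulr_ge0 ?cross_diff_ge0 ?(ltnW lt_iq) // ltW // spread // lt_iq.
  (* Both factors change sign when [i] and [q] are exchanged. *)
  - rewrite cross_diffC coefN mulrN -mulNr opprB.
    rewrite mulr_ge0 ?cross_diff_ge0 ?(ltnW lt_qi) // ltW //.
    by rewrite [f i * _]mulrC [f i.+1 * _]mulrC spread // lt_qi.
  - by rewrite [f q.+1 * f q]mulrC subrr mul0r.
have P_gt0 j : (j <= M)%N -> 0 < P`_j.
  move=> le_jM; suff : 0 < P`_j *+ 2 by rewrite pmulrn_lgt0.
  (* The term [i = 0] is positive in every degree up to [M]. *)
  rewrite symP big_ord_recl ltr_pwDl //; last first.
    apply: sumr_ge0 => i _; rewrite mulr_ge0 ?t_ge0 //.
      by rewrite mulr_ge0.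
    by rewrite -ltnS ltn_ord.
  rewrite bin0 mulr1 mulr_gt0 ?ltr0n // coefZ subn0 mulr_gt0 ?spread ?ltnSn //.
  rewrite cross_diffS // coefZ subn0 pochhammer0 mul1r mulr_gt0 ?ltr0n //.
  by rewrite -polyC1 pochhammerX_gt0.
have P_eq0 j : (M < j)%N -> P`_j = 0.
  move=> lt_Mj; apply/eqP; have := symP j.
  rewrite big1 => [/eqP|i _]; first by rewrite mulrn_eq0.
  rewrite coefZ [X in _ * (_ * X)]nth_default ?mulr0 //.
  by rewrite (leq_trans (size_cross_diff _ _ _)) // subnKC // -ltnS.
split=> //; apply/eqP; rewrite eqn_leq; apply/andP; split.
  by apply/leq_sizeP => j lt_Mj; apply: P_eq0.
rewrite ltnNge; apply/negP => /leq_sizeP/(_ M (leqnn M)) PM0.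
by have := P_gt0 M (leqnn M); rewrite PM0 ltxx.
Qed.
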